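(* Fix $0<a<1$ and, for each $d\ge 1$, let $\rho=\frac{a\pi}{d}$, $\tau_i=\frac{(i-1/2)\pi}{d}$ for $i=1,\dots,d$, $s_i=[\cos(\tau_i+\rho),\cos(\tau_i-\rho)]$, and let $V_d\in\mathbb{R}^{d\times d}$ be the matrix with entries $$[V_d]_{i,j}=\int_{s_i}U_{j-1}(x)\,\mathrm{d}x=\frac{2}{j}\sin(j\tau_i)\sin(j\rho).$$ Then $\kappa_F(V_d)$ grows asymptotically linearly with $d$; in particular, for all sufficiently large $d$, $$d\ \le\ \kappa_F(V_d)\ \le\ \frac{\sqrt{a\pi\,\mathrm{Si}(2a\pi)-\sin^2(a\pi)}}{\sin(a\pi)}\,d .$$
   Context: $U_{j-1}(x)=\frac{\sin(j\arccos x)}{\sin(\arccos x)}$ is the Chebyshev polynomial of the second kind of degree $j-1$. $\kappa_F(A)=\|A\|_F\|A^{-1}\|_F$ with $\|A\|_F=\sqrt{\mathrm{Tr}(A^\top A)}$ the Frobenius norm. $\mathrm{Si}(z)=\int_0^z\frac{\sin t}{t}\,\mathrm{d}t$ is the sine integral. *)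

(* Defs.v *)
From HB Require Import structures.
From mathcomp Require Import all_boot all_order all_algebra.
From mathcomp Require Import all_classical all_reals all_analysis.

Set Implicit Arguments.
Unset Strict Implicit.
Unset Printing Implicit Defensive.

Import Order.TTheory GRing.Theory Num.Theory.
Import numFieldNormedType.Exports.

Local Open Scope classical_set_scope.
Local Open Scope ring_scope.

(* Chebyshev polynomial of the second kind of degree n, as a function on
   [-1, 1].  At x = 1 and x = -1 the quotient is 0 / 0 = 0 instead of the
   polynomial's value; chebU is only ever integrated over an interval, so these
   two points do not matter. *)
Definition chebU (R : realType) (n : nat) (x : R) : R :=
  sin (n.+1%:R * acos x) / sin (acos x).

(* The integrand is 0 / 0 = 0 instead of 1 at t = 0, which is a null set. *)
Definition Si (R : realType) (z : R) : R :=
  if 0 <= z then \int[lebesgue_measure]_(t in `[0, z]) (sin t / t)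
  else - \int[lebesgue_measure]_(t in `[z, 0]) (sin t / t).

Definition frobenius_norm (R : rcfType) (m n : nat) (A : 'M[R]_(m, n)) : R :=
  Num.sqrt (\tr (A^T *m A)).

(* Meaningful for A \in unitmx only, since invmx A = A otherwise. *)
Definition frobenius_cond (R : rcfType) (n : nat) (A : 'M[R]_n) : R :=
  frobenius_norm A * frobenius_norm (invmx A).

Definition rho (R : realType) (a : R) (d : nat) : R := a * pi / d%:R.

(* i ranges over 1, ..., d *)
Definition tau (R : realType) (d i : nat) : R := (i%:R - 1 / 2) * pi / d%:R.

Definition segment (R : realType) (a : R) (d i : nat) : set R :=
  `[cos (tau R d i + rho a d), cos (tau R d i - rho a d)].

(* Ordinals start at 0: the entry at i, j : 'I_d is the entry of row i + 1 and
   column j + 1 in 1-based indexing, so U_{(j + 1) - 1} is chebU j. *)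
Definition vandermonde_segments (R : realType) (a : R) (d : nat) : 'M[R]_d :=
  \matrix_(i < d, j < d)
    \int[lebesgue_measure]_(x in segment a d i.+1) chebU j x.

(* Main.v *)
Require Import Defs.
From HB Require Import structures.
From mathcomp Require Import all_boot all_order all_algebra.
From mathcomp Require Import all_classical all_reals all_analysis.
From mathcomp Require Import measurable_realfun zify ring lra.

Set Implicit Arguments.
Unset Strict Implicit.
Unset Printing Implicit Defensive.

Import Order.TTheory GRing.Theory Num.Theory.
Import numFieldNormedType.Exports.

Local Open Scope classical_set_scope.
Local Open Scope ring_scope.

(** Write b = a pi and sinc x = sin x / x.  The closed form of the entries factors
    the matrix as V = S D, with S the matrix of the sin (j tau_i) and D diagonal.
    The columns of S are orthogonal (the discrete sine transform at the midpoints
    tau_i), so V^T V is diagonal, with j-th entry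
        g_j = 2 b (b/d) sinc (j b/d) ^ 2    (doubled for j = d),
    and kappa_F(V)^2 = (sum_j g_j) (sum_j 1 / g_j).  In particular V is invertible,
    and the Cauchy-Schwarz inequality gives kappa_F(V) >= d for every d >= 1.

    Up to a boundary term of order 1/d, coming from the doubled entry, the two sums
    are Riemann sums over [0, b] of sinc^2 and of 1/sinc^2, so that
        (kappa_F(V) / d)^2  -->  I J / b^2,
        I = int_0^b sinc^2 = Si(2b) - sin(b)^2 / b,    J = int_0^b 1/sinc^2.
    Since sinc is positive and decreasing on [0, pi), the mean value theorem gives
    J < b / sinc(b)^2 = b^3 / sin(b)^2; the limit is therefore strictly smaller than
    b I / sin(b)^2, the square of the constant in the theorem, and the upper bound
    holds for all large d.

    The Riemann sums are handled by primitives: the summands are monotone, so by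
    the mean value theorem the increments of a primitive lie between the terms of
    the left and of the right Riemann sum, and these two sums differ by O(1/d)
    (riemann_sum_cvg_nonincr).  For sinc^2 the primitive is
    Si(2x) - sin(x)^2 / x, for 1/sinc^2 its existence suffices. *)

(** * Primitives and integrals *)

Lemma is_derive_continuous (R : realType) (f : R -> R) (x l : R) :
  is_derive x 1 f l -> {for x, continuous f}.
Proof. by move=> fx; exact/differentiable_continuous/derivable1_diffP/ex_derive. Qed.

Lemma is_derive_within_continuous (R : realType) (f df : R -> R) (A : set R) :
  (forall x, A x -> is_derive x 1 f (df x)) -> {within A, continuous f}.
Proof.
move=> fdf; apply: continuous_in_subspaceT => x /set_mem/fdf.
exact: is_derive_continuous.
Qed.

(** The integrand f may take arbitrary values at the two endpoints: chebU and
    sin t / t are continuous only inside the interval, where they coincide with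
    continuous functions g that extend beyond it. *)
Lemma Rintegral_primitive (R : realType) (f g F : R -> R) (a b : R) :
  a <= b ->
  (forall x, a <= x <= b -> {for x, continuous g}) ->
  (forall x, a <= x <= b -> is_derive x 1 F (g x)) ->
  (forall x, a < x < b -> f x = g x) ->
  \int[lebesgue_measure]_(x in `[a, b]) f x = F b - F a.
Proof.
rewrite le_eqVlt => /orP[/eqP<- _ _ _|ab cg dF fg].
  by rewrite set_itv1 Rintegral_set1 subrr.
have wg : {within `[a, b], continuous g}.
  apply: continuous_in_subspaceT => x /set_mem/=.
  by rewrite in_itv/= => /cg.
have cF x : a <= x <= b -> {for x, continuous F}.
  by move=> /dF; exact: is_derive_continuous.
have LR : derivable_oo_LRcontinuous F a b.
  split=> [x||].
  - rewrite in_itv/= => /andP[/ltW ax /ltW xb].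
    by apply: ex_derive; apply: dF; rewrite ax.
  - by apply: cvg_at_right_filter; apply: cF; rewrite lexx ltW.
  - by apply: cvg_at_left_filter; apply: cF; rewrite lexx ltW.
have F'g : {in `]a, b[, F^`()%classic =1 g}.
  move=> x; rewrite in_itv/= => /andP[/ltW ax /ltW xb].
  by rewrite derive1E; apply: derive_val; apply: dF; rewrite ax.
have mg : measurable_fun `]a, b[ g.
  apply: (measurable_funS (E := `[a, b])) => //.
    exact: subset_itv_oo_cc.
  exact: subspace_continuous_measurable_fun.
have mf : measurable_fun `]a, b[ f.
  apply: eq_measurable_fun mg => x /set_mem/=.
  by rewrite in_itv/= => /fg ->.
rewrite /Rintegral integral_itv_bndoo; last exact/measurable_EFinP.
under eq_integral => x.
  by rewrite inE/= in_itv/= => /fg ->; over.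
rewrite -(integral_itv_bndoo true false); last exact/measurable_EFinP.
by rewrite (continuous_FTC2 ab wg LR F'g).
Qed.

(** The primitive is the integral from l, by the first fundamental theorem of
    calculus. *)
Lemma exists_primitive (R : realType) (f : R -> R) (l u : R) :
  (forall x, l <= x <= u -> {for x, continuous f}) ->
  exists F : R -> R, forall x, l < x < u -> is_derive x 1 F (f x).
Proof.
move=> cf; exists (fun x => \int[lebesgue_measure]_(t in `[l, x]) f t).
move=> x /andP[lx xu].
have fi : lebesgue_measure.-integrable `[l, u] (EFin \o f).
  apply: continuous_compact_integrable; first exact: segment_compact.
  apply: continuous_in_subspaceT => y /set_mem/=.
  by rewrite in_itv/= => /cf.
have [|dF F'] := continuous_FTC1_closed xu fi lx.
  by apply: cf; rewrite !ltW.
by apply: DeriveDef => //; rewrite -derive1E.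
Qed.

(** * Entries of the matrix *)

(** These are the Chebyshev polynomials of the first kind; the induction carries
    two consecutive ones, for the recurrence T_(n+2) = 2 X T_(n+1) - T_n. *)
Lemma chebyshev_cosine_poly (R : realType) (n : nat) :
  exists p : {poly R}, forall t, p.[cos t] = cos (n%:R * t).
Proof.
suff [] : (exists p : {poly R}, forall t, p.[cos t] = cos (n%:R * t)) /\
    (exists p : {poly R}, forall t, p.[cos t] = cos (n.+1%:R * t)) by [].
elim: n => [|n [[p pE] [q qE]]].
  split; [exists 1|exists 'X] => t; rewrite !hornerE; first by rewrite cos0.
  by rewrite ?mul1r.
split; first by exists q.
exists ('X *+ 2 * q - p) => t; rewrite !hornerE pE qE.
have -> : n.+2%:R * t = n.+1%:R * t + t by rewrite -natr1; ring.
have -> : n%:R * t = n.+1%:R * t - t by rewrite -natr1; ring.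
by rewrite cosB cosD; ring.
Qed.

(** Differentiate p (cos t) = cos ((n + 1) t) at t = acos x, where sin t does not
    vanish. *)
Lemma deriv_chebyshev (R : realType) (n : nat) (p : {poly R}) (x : R) :
  (forall t, p.[cos t] = cos (n.+1%:R * t)) -> -1 < x < 1 ->
  p^`().[x] = n.+1%:R * chebU n x.
Proof.
move=> pE x1; have /andP[xl xr] := x1.
have cx : cos (acos x) = x by apply: acosK; rewrite in_itv/= !ltW.
have s0 : 0 < sin (acos x).
  by apply: sin_gt0_pi; rewrite acos_gt0 ?acos_ltpi ?xl ?xr ?ltW.
have d1 : is_derive (acos x) 1 (horner p \o cos) (p^`().[x] * - sin (acos x)).
  by rewrite -[in p^`().[x]]cx; apply: is_derive1_comp.
have d2 : is_derive (acos x) 1 (cos \o *%R n.+1%:R)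
    (- sin (n.+1%:R * acos x) * n.+1%:R).
  apply: is_derive1_comp.
  by apply: is_derive_eq; rewrite /GRing.scale/= mulr1.
have E : horner p \o cos = cos \o *%R n.+1%:R.
  by apply/funext => t /=; exact: pE.
rewrite E in d1; have := @derive_val _ _ _ _ _ _ _ d1.
rewrite (@derive_val _ _ _ _ _ _ _ d2) /chebU => H.
apply: (mulIf (lt0r_neq0 s0)); rewrite -mulrA mulfVK ?lt0r_neq0//.
by apply: oppr_inj; rewrite -mulrN -H; ring.
Qed.

(** The primitive T_(n+1) / (n+1) takes the value cos ((n+1) t) / (n+1) at cos t for
    every real t, even outside [0, pi].  This matters because s - r may be negative
    and s + r may exceed pi for the outermost segments. *)
Lemma integral_chebU (R : realType) (n : nat) (s r : R) :
  cos (s + r) <= cos (s - r) ->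
  \int[lebesgue_measure]_(x in `[cos (s + r), cos (s - r)]) chebU n x
  = 2 / n.+1%:R * sin (n.+1%:R * s) * sin (n.+1%:R * r).
Proof.
move=> le_cos; have [p pE] := chebyshev_cosine_poly R n.+1.
have n0 : n.+1%:R != 0 :> R by rewrite pnatr_eq0.
rewrite (@Rintegral_primitive _ _ (horner (n.+1%:R^-1 *: p)^`())
  (horner (n.+1%:R^-1 *: p))) //.
- rewrite !hornerZ !pE mulrBr mulrDr cosB cosD.
  by field.
- by move=> x _; exact: continuous_horner.
- move=> x /andP[lx xu]; rewrite derivZ hornerZ (deriv_chebyshev pE) ?mulKf//.
  by rewrite (le_lt_trans _ lx) ?cos_geN1// (lt_le_trans xu) ?cos_le1.
Qed.

Lemma tau_itv (R : realType) (d : nat) (i : 'I_d) : 0 < tau R d i.+1 < pi.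
Proof.
have d0 : 0 < d%:R :> R by rewrite ltr0n (leq_ltn_trans _ (ltn_ord i)).
have id : i.+1%:R <= d%:R :> R by rewrite ler_nat.
have i0 : 0 <= i%:R :> R by [].
have -> : tau R d i.+1 = pi * ((i.+1%:R - 1 / 2) / d%:R).
  by rewrite /tau mulrAC mulrC.
apply/andP; split.
  by rewrite mulr_gt0 ?pi_gt0// divr_gt0// -natr1; lra.
by rewrite gtr_pMr ?pi_gt0// ltr_pdivrMr// mul1r; lra.
Qed.

Lemma mul_pi_itv (R : realType) (a : R) : 0 < a -> a < 1 -> 0 < a * pi < pi.
Proof.
move=> a0 a1; have p0 := pi_gt0 R.
by rewrite (mulr_gt0 a0 p0) gtr_pMl.
Qed.

Lemma node_itv (R : realType) (a : R) (d : nat) (j : 'I_d) :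
  0 < a -> a < 1 -> 0 < j.+1%:R * rho a d <= a * pi.
Proof.
move=> a0 a1; have p0 := pi_gt0 R.
have d0 : 0 < d%:R :> R by rewrite ltr0n (leq_ltn_trans _ (ltn_ord j)).
have /andP[b0 _] := mul_pi_itv a0 a1.
apply/andP; split; first by rewrite !mulr_gt0 ?invr_gt0.
rewrite /rho mulrCA ger_pMr//.
by rewrite ler_pdivrMr// mul1r ler_nat.
Qed.

(** Both tau_i and rho lie in (0, pi), so sin tau_i sin rho >= 0 and the endpoints of
    the segment are in order. *)
Lemma vandermonde_segmentsE (R : realType) (a : R) (d : nat) (i j : 'I_d) :
  0 < a -> a < 1 ->
  vandermonde_segments a d i j =
  2 / j.+1%:R * sin (j.+1%:R * tau R d i.+1) * sin (j.+1%:R * rho a d).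
Proof.
move=> a0 a1; rewrite mxE integral_chebU// cosD cosB.
have st : 0 <= sin (tau R d i.+1).
  by have /andP[t0 tpi] := tau_itv R i; rewrite sin_ge0_pi// !ltW.
have sr : 0 <= sin (rho a d).
  have d1 : (0 < d)%N by rewrite (leq_ltn_trans _ (ltn_ord i)).
  have := node_itv (Ordinal d1) a0 a1; rewrite mul1r => /andP[r0 rb].
  have /andP[_ bpi] := mul_pi_itv a0 a1.
  by rewrite sin_ge0_pi// (ltW r0) (le_trans rb) ?ltW.
by have := mulr_ge0 st sr; lra.
Qed.

(** * Riemann sums of monotone functions *)

Lemma cvg_divn0 (R : realType) (c : R) : (fun d : nat => c / d%:R) @ \oo --> 0.
Proof.
rewrite -[X in _ --> X](mulr0 c); apply: cvgM; first exact: cvg_cst.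
apply/gtr0_cvgV0; last exact: cvgr_idn.
by near=> d; rewrite ltr0n; near: d; exact: nbhs_infty_gt.
Unshelve. all: by end_near. Qed.

Definition riemann_sum (R : realType) (b : R) (f : R -> R) (d : nat) : R :=
  \sum_(j < d) b / d%:R * f (j.+1%:R * (b / d%:R)).

(** By the mean value theorem the increment of F over a cell lies between the
    values of f at the endpoints, times the mesh.  Summation traps the right
    Riemann sum between F b - F 0 and F b - F 0 - (b/d) (f 0 - f b). *)
Lemma riemann_sum_cvg_nonincr (R : realType) (F f : R -> R) (b : R) :
  0 < b ->
  (forall x, 0 <= x <= b -> {for x, continuous F}) ->
  (forall x, 0 < x < b -> is_derive x 1 F (f x)) ->
  (forall x y, 0 <= x -> x <= y -> y <= b -> f y <= f x) ->
  riemann_sum b f @ \oo --> F b - F 0.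
Proof.
move=> b0 cF dF fdecr.
have key d : (0 < d)%N ->
    F b - F 0 - b / d%:R * (f 0 - f b) <= riemann_sum b f d <= F b - F 0.
  move=> d0; have d0R : 0 < d%:R :> R by rewrite ltr0n.
  set h := b / d%:R; have h0 : 0 < h by rewrite divr_gt0.
  have hd : d%:R * h = b by rewrite mulrC divfK// lt0r_neq0.
  have step (j : 'I_d) : h * f (j.+1%:R * h) <= F (j.+1%:R * h) - F (j%:R * h)
      <= h * f (j%:R * h).
    have xb : j.+1%:R * h <= b by rewrite -hd ler_pM2r// ler_nat.
    have x0 : 0 <= j%:R * h by rewrite mulr_ge0// ltW.
    have lt_x : j%:R * h < j.+1%:R * h by rewrite ltr_pM2r// ltr_nat.
    have [x|x| c] := MVT (df := f) (f := F) lt_x.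
    - rewrite in_itv/= => /andP[lx xu]; apply: dF.
      by rewrite (le_lt_trans x0 lx) (lt_le_trans xu xb).
    - apply: continuous_in_subspaceT => {}x /set_mem/=.
      rewrite in_itv/= => /andP[lx xu]; apply: cF.
      by rewrite (le_trans x0 lx) (le_trans xu xb).
    rewrite in_itv/= => /andP[lc cu] ->.
    have -> : j.+1%:R * h - j%:R * h = h by rewrite -natr1; ring.
    have c0 := le_lt_trans x0 lc; have cb := lt_le_trans cu xb.
    by rewrite [f c * h]mulrC !ler_pM2l// !fdecr// ltW.
  have tele : \sum_(j < d) (F (j.+1%:R * h) - F (j%:R * h)) = F b - F 0.
    rewrite -(big_mkord xpredT (fun j => F (j.+1%:R * h) - F (j%:R * h))).
    by rewrite (telescope_sumr (fun j => F (j%:R * h)))// hd mul0r.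
  (* Passing from right to left endpoints changes the sum by one telescoping
     term, so the gap between the two sums is h (f 0 - f b). *)
  have shift : \sum_(j < d) h * f (j%:R * h) = riemann_sum b f d + h * (f 0 - f b).
    have := telescope_sumr (fun j => h * f (j%:R * h)) (leq0n d).
    rewrite big_mkord sumrB hd mul0r => E.
    by rewrite mulrBr -opprB -E /riemann_sum -/h; ring.
  apply/andP; split.
    rewrite lerBlDr -shift -tele; apply: ler_sum => j _.
    by case/andP: (step j).
  by rewrite -tele /riemann_sum -/h; apply: ler_sum => j _; case/andP: (step j).
apply: (squeeze_cvgr
  (f := fun d : nat => F b - F 0 - b / d%:R * (f 0 - f b))
  (h := fun=> F b - F 0)).
- by near=> d; apply: key; near: d; exact: nbhs_infty_gt.
- rewrite -[X in _ --> X]subr0; apply: cvgB; first exact: cvg_cst.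
  by under eq_fun do rewrite mulrAC; exact: cvg_divn0.
- exact: cvg_cst.
Unshelve. all: by end_near. Qed.

Lemma riemann_sum_cvg_nondecr (R : realType) (F f : R -> R) (b : R) :
  0 < b ->
  (forall x, 0 <= x <= b -> {for x, continuous F}) ->
  (forall x, 0 < x < b -> is_derive x 1 F (f x)) ->
  (forall x y, 0 <= x -> x <= y -> y <= b -> f x <= f y) ->
  riemann_sum b f @ \oo --> F b - F 0.
Proof.
move=> b0 cF dF fincr.
have H : riemann_sum b (fun x => - f x) @ \oo --> - F b - - F 0.
  apply: (@riemann_sum_cvg_nonincr _ (fun x => - F x)) => //.
  - by move=> x /cF Fx; exact: continuousN.
  - by move=> x /dF Fx; exact: is_deriveN.
  - by move=> x y x0 xy yb; rewrite lerN2 fincr.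
have -> : F b - F 0 = - (- F b - - F 0) by ring.
have -> : riemann_sum b f = (fun d => - riemann_sum b (fun x => - f x) d).
  by apply/funext => d; rewrite -sumrN; apply: eq_bigr => j _; ring.
exact: cvgN H.
Qed.

(** * The cardinal sine *)

Definition sinc (R : realType) (x : R) : R := if x == 0 then 1 else sin x / x.

Lemma mul_sinc (R : realType) (x : R) : x * sinc x = sin x.
Proof.
rewrite /sinc; case: ifPn => [/eqP->|x0]; first by rewrite mul0r sin0.
by rewrite mulrCA mulfV ?mulr1.
Qed.

Lemma sinc_gt0 (R : realType) (x : R) : - pi < x < pi -> 0 < sinc x.
Proof.
move=> /andP[Npi_x x_pi]; rewrite /sinc; case: eqP => // /eqP.
rewrite neq_lt => /orP[] x0.
- rewrite -[sin x / x]divrNN -sinN divr_gt0 ?oppr_gt0// sin_gt0_pi//.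
  by rewrite oppr_gt0 x0 ltrNl.
- by rewrite divr_gt0// sin_gt0_pi// x0.
Qed.

Lemma is_derive_sinc (R : realType) (x : R) : x != 0 ->
  is_derive x 1 (@sinc R) ((x * cos x - sin x) / x ^+ 2).
Proof.
move=> x0.
have d : is_derive x 1 (fun t => sin t * t^-1) ((x * cos x - sin x) / x ^+ 2).
  have dV := is_deriveV (f := id) x0 (is_derive_id x (1 : R)).
  have dM := is_deriveM (is_derive_sin x) dV.
  apply: is_derive_eq dM _.
  by rewrite /GRing.scale/=; field.
apply: near_eq_is_derive d.
near=> t; rewrite /sinc ifF//; apply/negbTE.
by near: t; exact: cvgr_neq0 x0.
Unshelve. all: by end_near. Qed.

Lemma continuous_sinc (R : realType) : continuous (@sinc R).
Proof.
move=> x; have [->|x0] := eqVneq x 0; last first.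
  exact: is_derive_continuous (is_derive_sinc x0).
(* At 0 the limit of sin h / h is the derivative of sin. *)
apply/continuous_withinNx; rewrite {2}/sinc eqxx.
have [+ sE] := is_derive_sin (0 : R).
rewrite cos0 in sE; rewrite /derivable /derive in sE * => c.
have {c sE} : h^-1 *: ((sin \o shift 0) h%:A - sin 0) @[h --> (0:R)^'] --> (1:R).
  by rewrite -[X in _ --> X]sE.
apply: cvg_trans; apply: near_eq_cvg; near=> t.
have t0 : t != 0 by near: t; exact: nbhs_dnbhs_neq.
by rewrite /sinc (negbTE t0)/= addr0 sin0 subr0 /GRing.scale/= mulr1 mulrC.
Unshelve. all: by end_near. Qed.

(** The function x cos x - sin x vanishes at 0 and has derivative - x sin x,
    which is negative on (0, pi). *)
Lemma mul_cos_lt_sin (R : realType) (x : R) : 0 < x < pi -> x * cos x < sin x.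
Proof.
move=> /andP[x0 xpi].
have dw (t : R) : is_derive t 1 (fun t => t * cos t - sin t) (- (t * sin t)).
  have dM := is_deriveM (is_derive_id t (1 : R)) (is_derive_cos t).
  apply: is_derive_eq (is_deriveB dM (is_derive_sin t)) _.
  by rewrite /GRing.scale/=; ring.
have [t|c] := MVT (f := fun t => t * cos t - sin t)
  (df := fun t => - (t * sin t)) x0 (fun t _ => dw t).
- exact: (is_derive_within_continuous (df := fun t => - (t * sin t))).
rewrite in_itv/= => /andP[c0 cx]; rewrite mul0r sin0 !subr0 => E.
rewrite -subr_lt0 E mulNr oppr_lt0 !mulr_gt0// sin_gt0_pi// c0.
exact: lt_trans xpi.
Qed.

Lemma sinc_decr (R : realType) (x y : R) :
  0 <= x -> x < y -> y < pi -> sinc y < sinc x.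
Proof.
move=> x0 xy ypi.
have [|z|z] := MVT (f := @sinc R) (df := fun z => (z * cos z - sin z) / z ^+ 2) xy.
- move=> z; rewrite in_itv/= => /andP[xz _]; apply: is_derive_sinc.
  by rewrite gt_eqF// (le_lt_trans x0 xz).
- by apply: continuous_subspaceT; exact: continuous_sinc.
rewrite in_itv/= => /andP[xz zy]; rewrite -subr_lt0 => ->.
have z0 := le_lt_trans x0 xz.
rewrite nmulr_rlt0 ?subr_gt0// pmulr_llt0 ?invr_gt0 ?exprn_gt0//.
by rewrite subr_lt0 mul_cos_lt_sin// z0 (lt_trans zy).
Qed.

(** The integral defining G starts at -1, so that G is derivable also at 0, where
    the integral defining Si starts. *)
Lemma Si_primitive (R : realType) (c : R) : 0 < c -> exists G : R -> R,
  (forall x, -1 < x < c -> is_derive x 1 G (sinc x)) /\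
  (forall x, 0 <= x < c -> Si x = G x - G 0).
Proof.
move=> c0; have [G dG] := @exists_primitive R (@sinc R) (-1) c
  (fun x _ => @continuous_sinc R x).
exists G; split=> // x /andP[x0 xc]; rewrite /Si x0.
apply: (Rintegral_primitive (g := @sinc R)) => //.
- by move=> t _; exact: continuous_sinc.
- move=> t /andP[t0 tx]; apply: dG.
  by rewrite (lt_le_trans _ t0) ?ltrN10// (le_lt_trans tx xc).
- by move=> t /andP[t0 _]; rewrite /sinc gt_eqF.
Qed.

(** Integration by parts, read backwards: Si (2 x) - x sinc(x)^2, which is
    Si (2 x) - sin(x)^2 / x away from 0, has derivative sinc^2. *)
Lemma riemann_sum_sinc2 (R : realType) (b : R) : 0 < b < pi ->
  riemann_sum b (fun x => sinc x ^+ 2) @ \oo --> Si (2 * b) - sin b ^+ 2 / b.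
Proof.
move=> /andP[b0 bpi].
have [G [dG SiG]] := @Si_primitive R (2 * b + 1) ltac:(lra).
pose F (x : R) := G (2 * x) - x * sinc x ^+ 2.
have dG2 (x : R) : 0 <= x <= b ->
    is_derive x 1 (fun x => G (2 * x)) (2 * sinc (2 * x)).
  move=> /andP[x0 xb].
  have d2 : is_derive x 1 ( *%R 2) (2 : R).
    apply: is_derive_eq (is_deriveZ 2 (is_derive_id x (1 : R))) _.
    by rewrite /GRing.scale/= mulr1.
  rewrite mulrC; apply: (is_derive1_comp (f := G) (g := *%R 2)).
  by apply: dG; lra.
have -> : Si (2 * b) - sin b ^+ 2 / b = F b - F 0.
  rewrite /F mul0r mulr0 SiG; last by lra.
  by rewrite -(mul_sinc b); field; rewrite gt_eqF.
apply: (riemann_sum_cvg_nonincr (F := F)) => //.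
- move=> x /dG2 d2; apply: continuousB.
    exact: is_derive_continuous d2.
  apply: continuousM; first exact: id.
  by apply: continuousM; exact: continuous_sinc.
- move=> x /andP[x0 xb]; have x_neq0 : x != 0 by rewrite gt_eqF.
  have ds := is_derive_sinc x_neq0.
  have dM := is_deriveM (is_derive_id x (1 : R)) (is_deriveX 2 ds).
  have d2 : is_derive x 1 (fun x => G (2 * x)) (2 * sinc (2 * x)).
    by apply: dG2; lra.
  have d3 : is_derive x 1 F _ := is_deriveB d2 dM.
  apply: is_derive_eq d3 _.
  rewrite /GRing.scale/= exprfctE /sinc mulf_eq0 pnatr_eq0/= (negbTE x_neq0).
  rewrite (mulr_natl x 2) sin_mulr2n.
  by field.
- move=> x y x0; rewrite le_eqVlt => /orP[/eqP->//|xy] yb.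
  by apply: lerXn2r; rewrite ?nnegrE ltW ?sinc_decr ?sinc_gt0//; lra.
Qed.

(** The limit l is the integral of 1/sinc^2 over [0, b].  It equals b / sinc(c)^2
    for some 0 < c < b, whence the strict bound, as sinc is decreasing. *)
Lemma riemann_sum_sincN2 (R : realType) (b : R) : 0 < b < pi ->
  exists l : R, [/\ 0 < l, l < b / sinc b ^+ 2 &
    riemann_sum b (fun x => sinc x ^- 2) @ \oo --> l].
Proof.
move=> /andP[b0 bpi].
pose f (x : R) := sinc x ^- 2.
have s0 (x : R) : - b <= x <= (b + pi) / 2 -> 0 < sinc x.
  by move=> ?; apply: sinc_gt0; lra.
(* The interval reaches beyond [0, b] on both sides, so that F is derivable at
   0 and b as well, but stays inside (- pi, pi), where sinc is positive. *)
have [|F dF] := @exists_primitive R f (- b) ((b + pi) / 2).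
  move=> x /s0 sx; apply: cvgV; first by rewrite expf_neq0// gt_eqF.
  by apply: cvgM; exact: continuous_sinc.
have fincr (x y : R) : 0 <= x -> x < y -> y <= b -> f x < f y.
  move=> x0 xy yb; have sx : 0 < sinc x by apply: s0; lra.
  have sy : 0 < sinc y by apply: s0; lra.
  rewrite /f ltf_pV2 ?posrE ?exprn_gt0// ltrXn2r ?nnegrE ?(ltW sx) ?(ltW sy)//=.
  by apply: sinc_decr; lra.
have dF0 (x : R) : 0 <= x <= b -> is_derive x 1 F (f x).
  by move=> ?; apply: dF; lra.
exists (F b - F 0).
have dFoo x : x \in `]0, b[ -> is_derive x 1 F (f x).
  by rewrite in_itv/= => ?; apply: dF; lra.
have [|c] := MVT b0 dFoo.
- exact: (is_derive_within_continuous (df := f)).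
rewrite in_itv/= subr0 => /andP[c0 cb] E.
have fc : 0 < f c by rewrite invr_gt0 exprn_gt0// s0//; lra.
split.
- by rewrite E mulr_gt0.
- by rewrite E mulrC ltr_pM2l// fincr// ltW.
- apply: (riemann_sum_cvg_nondecr (F := F)) => //.
  + by move=> x x0b; exact: is_derive_continuous (dF0 x x0b).
  + move=> x y x0; rewrite le_eqVlt => /orP[/eqP->//|xy] yb.
    by rewrite ltW ?fincr.
Qed.

(** * Discrete orthogonality of sines *)

Lemma sum_cos_nodes (R : realType) (d m : nat) : (0 < m < d.*2)%N ->
  \sum_(i < d) cos (m%:R * tau R d i.+1) = 0.
Proof.
move=> /andP[m0 md]; have d0 : (0 < d)%N by case: d md => //.
have d0R : d%:R != 0 :> R by rewrite pnatr_eq0 -lt0n.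
have s0 : 0 < sin (m%:R * pi / (2 * d%:R) : R).
  apply: sin_gt0_pi; rewrite divr_gt0 ?mulr_gt0 ?pi_gt0 ?ltr0n//=.
  rewrite ltr_pdivrMr ?mulr_gt0 ?ltr0n// mulrC ltr_pM2l ?pi_gt0//.
  by rewrite -natrM ltr_nat mul2n.
have sin_nat k : sin (k%:R * pi : R) = 0.
  have := alternatingn (@sinDpi R) k 0.
  by rewrite sin0 mulr0 add0r mulr_natl.
(* Multiplied by 2 sin (m pi / 2d), each cosine is a difference of two sines. *)
apply: (mulfI (x := 2 * sin (m%:R * pi / (2 * d%:R)))).
  by rewrite mulf_neq0 ?pnatr_eq0// gt_eqF.
rewrite mulr0 mulr_sumr.
pose F (i : nat) : R := sin (i%:R * (m%:R * pi / d%:R)).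
transitivity (\sum_(i < d) (F i.+1 - F i)).
  apply: eq_bigr => i _; rewrite /F /tau.
  have -> : i.+1%:R * (m%:R * pi / d%:R) =
    m%:R * ((i.+1%:R - 1 / 2) * pi / d%:R) + m%:R * pi / (2 * d%:R) :> R by field.
  have -> : i%:R * (m%:R * pi / d%:R) =
    m%:R * ((i.+1%:R - 1 / 2) * pi / d%:R) - m%:R * pi / (2 * d%:R) :> R.
    by rewrite -natr1; field.
  by rewrite sinD sinB; ring.
rewrite -(big_mkord xpredT (fun i => F i.+1 - F i)) telescope_sumr// /F.
have -> : d%:R * (m%:R * pi / d%:R) = m%:R * pi :> R by field.
by rewrite sin_nat mul0r sin0 subrr.
Qed.

(** Each 2 d tau_i is an odd multiple of pi, so every term is -1. *)
Lemma sum_cos_nodes_double (R : realType) (d : nat) :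
  \sum_(i < d) cos (d.*2%:R * tau R d i.+1) = - d%:R.
Proof.
rewrite (eq_bigr (fun=> -1)) => [|i _]; last first.
  have d0R : d%:R != 0 :> R by rewrite pnatr_eq0 -lt0n (leq_ltn_trans _ (ltn_ord i)).
  have -> : d.*2%:R * tau R d i.+1 = pi + pi *+ 2 *+ i.
    rewrite /tau -mul2n natrM -natr1 -[X in pi + X]mulr_natr -(mulr_natr pi 2).
    by field.
  by rewrite (periodicn (@cosD2pi R)) cospi.
by rewrite sumr_const card_ord mulNrn.
Qed.

(** By the product formula the sum is half the difference of the cosine sums of
    frequencies j - k and j + k (with 1-based j and k).  These vanish except for
    frequency 0, which occurs when j = k, and for frequency 2 d, which occurs only
    when j = k = d and doubles the value. *)
Lemma sum_sin_nodes (R : realType) (d : nat) (j k : 'I_d) :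
  \sum_(i < d) sin (j.+1%:R * tau R d i.+1) * sin (k.+1%:R * tau R d i.+1) =
  (d%:R / 2 * (j.+1 == d).+1%:R) *+ (j == k).
Proof.
wlog kj : j k / (k <= j)%N.
  move=> H; case: (leqP k j) => [/H//|/ltnW/H].
  under eq_bigr do rewrite mulrC.
  by move=> ->; rewrite [k == j]eq_sym; case: (eqVneq j k) => [->|].
have E (i : 'I_d) : sin (j.+1%:R * tau R d i.+1) * sin (k.+1%:R * tau R d i.+1) =
    (cos ((j - k)%:R * tau R d i.+1) - cos ((j.+1 + k.+1)%:R * tau R d i.+1)) / 2.
  have -> : (j - k)%:R * tau R d i.+1 =
      j.+1%:R * tau R d i.+1 - k.+1%:R * tau R d i.+1.
    by rewrite natrB// -!natr1; ring.
  by rewrite natrD [(_ + _) * tau _ _ _]mulrDl cosB cosD; field.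
rewrite (eq_bigr _ (fun i _ => E i)) -mulr_suml sumrB.
have jd := ltn_ord j; have kd := ltn_ord k.
have -> : \sum_(i < d) cos ((j - k)%:R * tau R d i.+1) = d%:R *+ (j == k).
  case: eqVneq => [->|njk].
    rewrite subnn (eq_bigr (fun=> 1)) ?sumr_const ?card_ord// => i _.
    by rewrite mul0r cos0.
  have jk : j != k :> nat by [].
  by apply: sum_cos_nodes; lia.
have [jd1|jd1] := eqVneq j.+1 d.
  have [jk|njk] := eqVneq j k.
    rewrite -jk (_ : (j.+1 + j.+1)%N = d.*2); last by rewrite jd1 addnn.
    rewrite sum_cos_nodes_double.
    by rewrite !mulr1n /=; field.
  have jk : j != k :> nat by [].
  by rewrite sum_cos_nodes ?subrr ?mul0r//; lia.
rewrite sum_cos_nodes ?subr0; last by lia.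
by case: eqVneq => _; rewrite ?mulr0n ?mul0r ?mulr1n ?mulr1.
Qed.

(** * Condition number of a matrix with orthogonal columns *)

(** When A^T A is diagonal, so is A^-1 A^-T, with the inverse entries; the traces
    of these two matrices are the squares of the norms of A and A^-1. *)
Lemma diagonal_gram (R : rcfType) (n : nat) (A : 'M[R]_n) (g : 'I_n -> R) :
  (forall j, g j != 0) -> A^T *m A = diag_mx (\row_j g j) ->
  A \in unitmx /\
  frobenius_cond A = Num.sqrt (\sum_j g j) * Num.sqrt (\sum_j (g j)^-1).
Proof.
move=> g0 AA.
have GG : diag_mx (\row_j g j) *m diag_mx (\row_j (g j)^-1) = 1%:M.
  rewrite mulmx_diag -diag_const_mx; congr diag_mx.
  by apply/rowP => j; rewrite !mxE mulfV.
have /mulmx1_unit[Gu _] := GG.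
have Au : A \in unitmx by move: Gu; rewrite -AA unitmx_mul => /andP[].
split=> //; rewrite /frobenius_cond /frobenius_norm AA mxtrace_diag.
rewrite mxtrace_mulC.
have -> : invmx A *m (invmx A)^T = diag_mx (\row_j (g j)^-1).
  rewrite trmx_inv; apply: (can_inj (mulKmx Gu)).
  rewrite GG -AA -!mulmxA (mulmxA A) mulmxV// mul1mx mulmxV//.
  by rewrite unitmx_tr.
rewrite mxtrace_diag.
by congr (Num.sqrt _ * Num.sqrt _); apply: eq_bigr => j _; rewrite mxE.
Qed.

(** This is the Cauchy-Schwarz inequality.  It follows by summing the tangent bound
    1/x >= 2 u - u^2 x with u = n / sum_j g_j. *)
Lemma sum_mul_sumV_ge (R : realFieldType) (n : nat) (g : 'I_n -> R) :
  (forall j, 0 < g j) -> n%:R ^+ 2 <= (\sum_j g j) * (\sum_j (g j)^-1).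
Proof.
move=> g0; case: n g g0 => [|n] g g0; first by rewrite !big_ord0 expr0n mul0r.
set s := \sum_j g j.
have s0 : 0 < s.
  by rewrite /s big_ord_recl ltr_pwDl ?g0// sumr_ge0// => j _; exact: ltW.
have n0 : 0 < n.+1%:R :> R by rewrite ltr0n.
pose u := n.+1%:R / s; have u0 : 0 < u by rewrite divr_gt0.
have : \sum_j (2 * u - u ^+ 2 * g j) <= \sum_j (g j)^-1.
  apply: ler_sum => j _; have gj := g0 j; rewrite -subr_ge0.
  have -> : (g j)^-1 - (2 * u - u ^+ 2 * g j) = (1 - u * g j) ^+ 2 / g j.
    by field; rewrite gt_eqF.
  by rewrite divr_ge0 ?sqr_ge0// ltW.
rewrite sumrB sumr_const card_ord -mulr_sumr -/s => H.
rewrite mulrC -ler_pdivrMr//; apply: le_trans H.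
rewrite le_eqVlt; apply/orP; left; apply/eqP.
by rewrite -(mulr_natr (2 * u)) /u; field; rewrite gt_eqF.
Qed.

(** * Condition number of the Vandermonde matrix *)

(** This is the squared norm (2 / (j+1) * sin ((j+1) rho))^2 * d/2 of column j
    (0-based), doubled for the last one, after the substitution sin x = x sinc x and
    d rho = a pi, which turns the sum over j into a Riemann sum. *)
Definition gram_entry (R : realType) (a : R) (d : nat) (j : 'I_d) : R :=
  2 * (a * pi) * (rho a d * sinc (j.+1%:R * rho a d) ^+ 2) * (j.+1 == d).+1%:R.

Lemma gram_entry_gt0 (R : realType) (a : R) (d : nat) (j : 'I_d) :
  0 < a -> a < 1 -> 0 < gram_entry a j.
Proof.
move=> a0 a1.
have d0 : 0 < d%:R :> R by rewrite ltr0n (leq_ltn_trans _ (ltn_ord j)).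
have /andP[b0 bpi] := mul_pi_itv a0 a1; have /andP[x0 xb] := node_itv j a0 a1.
have s0 : 0 < sinc (j.+1%:R * rho a d) by apply: sinc_gt0; lra.
have r0 : 0 < rho a d by rewrite divr_gt0.
rewrite /gram_entry mulr_gt0 ?ltr0n// mulr_gt0//; first by rewrite mulr_gt0.
by rewrite mulr_gt0 ?exprn_gt0.
Qed.

Lemma gram_vandermonde (R : realType) (a : R) (d : nat) : 0 < a -> a < 1 ->
  (vandermonde_segments a d)^T *m vandermonde_segments a d =
  diag_mx (\row_j gram_entry a j).
Proof.
move=> a0 a1; apply/matrixP => j k; rewrite !mxE.
under eq_bigr do rewrite mxE !vandermonde_segmentsE//.
pose c (j : 'I_d) := 2 / j.+1%:R * sin (j.+1%:R * rho a d).
transitivity (c j * c k * \sum_(i < d)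
    sin (j.+1%:R * tau R d i.+1) * sin (k.+1%:R * tau R d i.+1)).
  by rewrite mulr_sumr; apply: eq_bigr => i _; rewrite /c; ring.
rewrite sum_sin_nodes; case: (eqVneq j k) => [<-|_]; last by rewrite !mulr0n mulr0.
have d0 : d%:R != 0 :> R by rewrite pnatr_eq0 -lt0n (leq_ltn_trans _ (ltn_ord j)).
rewrite !mulr1n /gram_entry /c -mul_sinc /rho.
by field; rewrite d0 nat1r pnatr_eq0.
Qed.

Lemma vandermonde_segments_unit (R : realType) (a : R) (d : nat) :
  0 < a -> a < 1 -> vandermonde_segments a d \in unitmx.
Proof.
move=> a0 a1; have g0 (j : 'I_d) : gram_entry a j != 0.
  by rewrite gt_eqF ?gram_entry_gt0.
by have [] := diagonal_gram g0 (gram_vandermonde d a0 a1).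
Qed.

(** The Gram entries and their inverses are summed in this form: the weight w is the
    same for all terms but the last. *)
Lemma sum_mul_last (R : realFieldType) (n : nat) (u : 'I_n.+1 -> R) (w : bool -> R) :
  \sum_j u j * w (j.+1 == n.+1) =
  w false * (\sum_j u j) + (w true - w false) * u ord_max.
Proof.
rewrite !big_ord_recr/= eqxx.
rewrite (eq_bigr (fun i : 'I_n => u (widen_ord (leqnSn n) i) * w false)).
  by rewrite -mulr_suml; ring.
by move=> i _; rewrite eqSS ltn_eqF.
Qed.

(** The ratio (kappa_F / d)^2 for d > 0.  The first factor is the sum of the Gram
    entries and the second one is the sum of their inverses divided by d^2.  The
    terms outside the Riemann sums come from the doubled last entry. *)
Definition cond_sqr (R : realType) (a : R) (d : nat) : R :=
  let b := a * pi in
  (2 * b * (riemann_sum b (fun x => sinc x ^+ 2) d + b / d%:R * sinc b ^+ 2)) *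
  ((2 * b ^+ 3)^-1 *
     (riemann_sum b (fun x => sinc x ^- 2) d - b / d%:R / (2 * sinc b ^+ 2))).

(** The lower bound is the Cauchy-Schwarz inequality for the Gram entries; it holds
    for every d > 0, not only asymptotically. *)
Lemma frobenius_cond_vandermonde (R : realType) (a : R) (d : nat) :
  0 < a -> a < 1 -> (0 < d)%N ->
  frobenius_cond (vandermonde_segments a d) = Num.sqrt (cond_sqr a d) * d%:R /\
  1 <= cond_sqr a d.
Proof.
move=> a0 a1; case: d => // n _.
have g_gt0 (j : 'I_n.+1) : 0 < gram_entry a j by exact: gram_entry_gt0.
have g0 (j : 'I_n.+1) : gram_entry a j != 0 by rewrite gt_eqF.
have [_ ->] := diagonal_gram g0 (gram_vandermonde n.+1 a0 a1).
have CS := sum_mul_sumV_ge g_gt0.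
have d0 : n.+1%:R != 0 :> R by rewrite pnatr_eq0.
have /andP[b0 bpi] := mul_pi_itv a0 a1.
have b_neq0 : a * pi != 0 by rewrite gt_eqF.
have sb : sinc (a * pi) != 0 by rewrite gt_eqF// sinc_gt0//; lra.
have last_node : n.+1%:R * rho a n.+1 = a * pi by rewrite mulrC divfK.
have S1 : \sum_(j < n.+1) gram_entry a j = 2 * (a * pi) *
    (riemann_sum (a * pi) (fun x => sinc x ^+ 2) n.+1 +
     rho a n.+1 * sinc (a * pi) ^+ 2).
  pose u (j : 'I_n.+1) := 2 * (a * pi) *
    (rho a n.+1 * sinc (j.+1%:R * rho a n.+1) ^+ 2).
  rewrite [LHS](sum_mul_last u (fun c : bool => c.+1%:R)).
  rewrite /u last_node -mulr_sumr.
  rewrite /riemann_sum -/(rho a n.+1) /=.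
  by ring.
have S2 : \sum_(j < n.+1) (gram_entry a j)^-1 =
    n.+1%:R ^+ 2 * ((2 * (a * pi) ^+ 3)^-1 *
      (riemann_sum (a * pi) (fun x => sinc x ^- 2) n.+1 -
       rho a n.+1 / (2 * sinc (a * pi) ^+ 2))).
  pose u (j : 'I_n.+1) := n.+1%:R ^+ 2 * (2 * (a * pi) ^+ 3)^-1 *
    (rho a n.+1 * sinc (j.+1%:R * rho a n.+1) ^- 2).
  rewrite (eq_bigr (fun j => u j * (j.+1 == n.+1).+1%:R^-1)) => [|j _].
    rewrite [LHS](sum_mul_last u (fun c : bool => c.+1%:R^-1)).
    rewrite /u last_node -mulr_sumr.
    rewrite /riemann_sum -/(rho a n.+1) /=.
    move: b_neq0 sb; set b := a * pi => b_neq0 sb.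
    by field; rewrite b_neq0 sb.
  have := gt_eqF (g_gt0 j); rewrite /gram_entry => /negbT.
  rewrite !mulf_eq0 !negb_or /u /rho => /andP[/andP[_ /andP[_ /andP[s0 _]]] _].
  set s := sinc _ in s0 *.
  move: b_neq0; set b := a * pi => b_neq0.
  by field; rewrite !nat1r !pnatr_eq0 s0 b_neq0.
have E : (\sum_(j < n.+1) gram_entry a j) * (\sum_(j < n.+1) (gram_entry a j)^-1) =
    cond_sqr a n.+1 * n.+1%:R ^+ 2.
  by rewrite S1 S2 /cond_sqr -/(rho a n.+1); ring.
have Sg : 0 <= \sum_(j < n.+1) gram_entry a j.
  by apply: sumr_ge0 => j _; rewrite ltW ?g_gt0.
split; last by rewrite -(ler_pM2r (exprn_gt0 2 (ltr0Sn R n))) mul1r -E.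
rewrite -sqrtrM// E sqrtrM; last first.
  rewrite -(pmulr_lge0 _ (exprn_gt0 2 (ltr0Sn R n))) -E mulr_ge0// sumr_ge0// => j _.
  by rewrite invr_ge0 ltW ?g_gt0.
by rewrite sqrtr_sqr ger0_norm.
Qed.

(** Dropping the boundary terms, the limit is b K J / b^3, where K and
    J < b / sinc(b)^2 are the limits of the two Riemann sums.  Strictness of this
    bound passes to the product because K > 0, which holds as the limit is at
    least 1. *)
Lemma cond_sqr_cvg (R : realType) (a : R) : 0 < a -> a < 1 -> exists2 l : R,
  l < (a * pi * Si (2 * a * pi) - sin (a * pi) ^+ 2) / sin (a * pi) ^+ 2 &
  cond_sqr a @ \oo --> l.
Proof.
move=> a0 a1.
have b_itv := mul_pi_itv a0 a1; have /andP[b0 bpi] := b_itv.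
have sb : 0 < sinc (a * pi) by apply: sinc_gt0; lra.
have [l [l0 l_lt cvgl]] := riemann_sum_sincN2 b_itv.
have cvg1 := riemann_sum_sinc2 b_itv.
set K := Si (2 * (a * pi)) - sin (a * pi) ^+ 2 / (a * pi) in cvg1.
have cvgX : cond_sqr a @ \oo -->
    2 * (a * pi) * (K + 0 * sinc (a * pi) ^+ 2) *
    ((2 * (a * pi) ^+ 3)^-1 * (l - 0 / (2 * sinc (a * pi) ^+ 2))).
  apply: cvgM.
    apply: cvgM; first exact: cvg_cst.
    apply: cvgD; first exact: cvg1.
    by apply: cvgM; [exact: cvg_divn0|exact: cvg_cst].
  apply: cvgM; first exact: cvg_cst.
  apply: cvgB; first exact: cvgl.
  by apply: cvgM; [exact: cvg_divn0|exact: cvg_cst].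
have KE : a * pi * Si (2 * a * pi) - sin (a * pi) ^+ 2 = a * pi * K.
  rewrite /K -[2 * a * pi]mulrA mulrBr [a * pi * (_ / _)]mulrCA.
  by rewrite mulfV ?mulr1// gt_eqF.
rewrite KE -mul_sinc; clear cvg1 KE; clearbody K.
move: b0 sb l_lt K cvgX; set b := a * pi; set s := sinc b => b0 sb l_lt K.
have -> : 2 * b * (K + 0 * s ^+ 2) * ((2 * b ^+ 3)^-1 * (l - 0 / (2 * s ^+ 2))) =
    b * K * (l / b ^+ 3).
  by field; rewrite !gt_eqF.
move=> cvgX; exists (b * K * (l / b ^+ 3)) => //.
have X1 : 1 <= b * K * (l / b ^+ 3).
  apply: cvgr_to_ge cvgX _; near=> d.
  have d0 : (0 < d)%N by near: d; exact: nbhs_infty_gt.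
  by have [] := frobenius_cond_vandermonde a0 a1 d0.
have lb0 : 0 < l / b ^+ 3 by rewrite divr_gt0 ?exprn_gt0.
have K0 : 0 < b * K by rewrite -(pmulr_lgt0 _ lb0) (lt_le_trans ltr01).
rewrite ltr_pM2l// ltr_pdivrMr ?exprn_gt0//; apply: (lt_le_trans l_lt).
rewrite le_eqVlt; apply/orP; left; apply/eqP.
by field; rewrite !gt_eqF.
Unshelve. all: by end_near. Qed.

Theorem theorem3p20 (R : realType) (a : R) (a_gt0 : 0 < a) (a_lt1 : a < 1) :
  [/\ (* closed form of the entries *)
      forall (d : nat) (i j : 'I_d),
        vandermonde_segments a d i j =
          2 / j.+1%:R * sin (j.+1%:R * tau R d i.+1) * sin (j.+1%:R * rho a d),
      (* the condition number is defined *)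
      forall d : nat, (1 <= d)%N -> vandermonde_segments a d \in unitmx,
      (* asymptotically linear growth *)
      exists2 C : R, 0 < C &
        (fun d : nat => frobenius_cond (vandermonde_segments a d) / d%:R)
          @ \oo --> C
    & (* two-sided bound for all sufficiently large d *)
      \forall d \near \oo,
        d%:R <= frobenius_cond (vandermonde_segments a d) <=
          Num.sqrt (a * pi * Si (2 * a * pi) - sin (a * pi) ^+ 2)
            / sin (a * pi) * d%:R].
Proof.
have condE d := @frobenius_cond_vandermonde R a d a_gt0 a_lt1.
have [l l_lt cvgl] := cond_sqr_cvg a_gt0 a_lt1.
have l1 : 1 <= l.
  apply: cvgr_to_ge cvgl _; near=> d.
  have d0 : (0 < d)%N by near: d; exact: nbhs_infty_gt.
  by have [] := condE d d0.
have /andP[b0 bpi] := mul_pi_itv a_gt0 a_lt1.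
have sb : 0 < sin (a * pi) by rewrite sin_gt0_pi// b0.
set K := a * pi * Si _ - _ in l_lt *.
have K0 : 0 < K.
  have := lt_trans (lt_le_trans ltr01 l1) l_lt.
  by rewrite pmulr_lgt0 ?invr_gt0 ?exprn_gt0.
split.
- by move=> d i j; exact: vandermonde_segmentsE.
- by move=> d _; exact: vandermonde_segments_unit.
- exists (Num.sqrt l); first by rewrite sqrtr_gt0 (lt_le_trans ltr01).
  have cvgs : (fun d => Num.sqrt (cond_sqr a d)) @ \oo --> Num.sqrt l.
    by apply: continuous_cvg => //; exact: sqrt_continuous.
  apply: cvg_trans cvgs; apply: near_eq_cvg; near=> d.
  have d0 : (0 < d)%N by near: d; exact: nbhs_infty_gt.
  by have [-> _] := condE d d0; rewrite mulfK// pnatr_eq0 -lt0n.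
- near=> d.
  have d0 : (0 < d)%N by near: d; exact: nbhs_infty_gt.
  have d0R : 0 < d%:R :> R by rewrite ltr0n.
  have [-> X1] := condE d d0.
  have Xlt : cond_sqr a d < K / sin (a * pi) ^+ 2 by near: d; exact: cvgr_lt l_lt.
  rewrite ler_pMl// ler_pM2r//; apply/andP; split.
    by rewrite -[leLHS]sqrtr1 ler_wsqrtr.
  have -> : Num.sqrt K / sin (a * pi) = Num.sqrt (K / sin (a * pi) ^+ 2).
    by rewrite sqrtrM ?sqrtrV ?sqrtr_sqr ?ger0_norm ?sqr_ge0// ltW.
  by rewrite ler_wsqrtr// ltW.
Unshelve. all: by end_near. Qed.
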